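(* Let $X$ be a Polish space and $\mathbf f=(f_n)_n$ a sequence of real-valued Borel functions on $X$. Let $$\mathcal L^1_{\mathbf f}=\{L\in[\mathbb N]:(f_n)_{n\in L}\text{ converges pointwise to a Baire-1 function}\}.$$ Then for every Borel set $C\subseteq\mathcal L^1_{\mathbf f}$, $$\sup\{\alpha(f_L):L\in C\}<\omega_1,$$ where $f_L$ denotes the pointwise limit of $(f_n)_{n\in L}$.
   Context: $[\mathbb N]$ is the set of infinite subsets of $\mathbb N$, a Polish subspace of $2^{\mathbb N}$; $(f_n)_{n\in L}$ is the subsequence along the increasing enumeration of $L$. Separation rank: for $f:X\to\mathbb R$, reals $a<b$ and closed $F\subseteq X$, $F'_{f,a,b}=\overline{F\cap[f<a]}\cap\overline{F\cap[f>b]}$; iterate transfinitely ($F^{(0)}=F$, successor = derivative, intersections at limits); $\alpha(f,F,a,b)$ is the least $\xi$ with $F^{(\xi)}_{f,a,b}=\varnothing$ if one exists below $\omega_1$, else $\omega_1$; $\alpha(f,a,b)=\alpha(f,X,a,b)$ and $\alpha(f)=\sup\{\alpha(f,a,b):a,b\in\mathbb Q,\ a<b\}$. *)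

(* Defs.v *)
From Stdlib Require Import Reals QArith Qreals.
Open Scope R_scope.

Definition is_metric {X : Type} (d : X -> X -> R) : Prop :=
  (forall x y, 0 <= d x y) /\ (forall x y, d x y = 0 <-> x = y) /\
  (forall x y, d x y = d y x) /\ (forall x y z, d x z <= d x y + d y z).

Definition d_cauchy {X : Type} (d : X -> X -> R) (u : nat -> X) : Prop :=
  forall eps, 0 < eps -> exists N, forall n m, (N <= n)%nat -> (N <= m)%nat -> d (u n) (u m) < eps.

Definition d_conv {X : Type} (d : X -> X -> R) (u : nat -> X) (x : X) : Prop :=
  forall eps, 0 < eps -> exists N, forall n, (N <= n)%nat -> d (u n) x < eps.

Definition d_complete {X : Type} (d : X -> X -> R) : Prop :=
  forall u, d_cauchy d u -> exists x, d_conv d u x.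

(* countable dense subset (enumerated with option so that X may be empty) *)
Definition d_separable {X : Type} (d : X -> X -> R) : Prop :=
  exists s : nat -> option X, forall x eps, 0 < eps ->
    exists n y, s n = Some y /\ d x y < eps.

Definition polish {X : Type} (d : X -> X -> R) : Prop :=
  is_metric d /\ d_complete d /\ d_separable d.

Definition d_open {X : Type} (d : X -> X -> R) (U : X -> Prop) : Prop :=
  forall x, U x -> exists eps, 0 < eps /\ forall y, d x y < eps -> U y.

Definition d_closure {X : Type} (d : X -> X -> R) (A : X -> Prop) : X -> Prop :=
  fun x => forall eps, 0 < eps -> exists y, A y /\ d x y < eps.

Inductive borel {T : Type} (op : (T -> Prop) -> Prop) : (T -> Prop) -> Prop :=
| borel_open U : op U -> borel op U
| borel_compl A : borel op A -> borel op (fun x => ~ A x)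
| borel_union (A : nat -> T -> Prop) :
    (forall n, borel op (A n)) -> borel op (fun x => exists n, A n x).

Definition borel_fun {X : Type} (d : X -> X -> R) (f : X -> R) : Prop :=
  forall U : R -> Prop, open_set U -> borel (d_open d) (fun x => U (f x)).

Definition d_continuous {X : Type} (d : X -> X -> R) (f : X -> R) : Prop :=
  forall x eps, 0 < eps -> exists delta, 0 < delta /\
    forall y, d x y < delta -> Rabs (f y - f x) < eps.

Definition baire1 {X : Type} (d : X -> X -> R) (g : X -> R) : Prop :=
  exists h : nat -> X -> R, (forall n, d_continuous d (h n)) /\
    forall x, Un_cv (fun n => h n x) (g x).

Definition cantor_open (U : (nat -> bool) -> Prop) : Prop :=
  forall x, U x -> exists n, forall y, (forall k, (k < n)%nat -> y k = x k) -> U y.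

Definition infinite_set (L : nat -> bool) : Prop :=
  forall n, exists m, (n <= m)%nat /\ L m = true.

Definition borel_in_infsets (C : (nat -> bool) -> Prop) : Prop :=
  exists B, borel cantor_open B /\ forall L, C L <-> (infinite_set L /\ B L).

Definition increasing_enum (L : nat -> bool) (e : nat -> nat) : Prop :=
  (forall k, (e k < e (S k))%nat) /\ (forall m, L m = true <-> exists k, e k = m).

Definition subseq_conv {X : Type} (f : nat -> X -> R) (L : nat -> bool) (g : X -> R) : Prop :=
  forall e, increasing_enum L e -> forall x, Un_cv (fun k => f (e k) x) (g x).

(* Brouwer trees: every countable ordinal is denoted by one of them. *)
Inductive cord : Type :=
| cO : cord
| cS : cord -> cord
| cLim : (nat -> cord) -> cord.

Definition sep_deriv {X : Type} (d : X -> X -> R) (f : X -> R) (a b : R)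
  (F : X -> Prop) : X -> Prop :=
  fun x => d_closure d (fun y => F y /\ f y < a) x /\
           d_closure d (fun y => F y /\ b < f y) x.

Fixpoint sep_iter {X : Type} (d : X -> X -> R) (f : X -> R) (a b : R)
  (o : cord) : X -> Prop :=
  match o with
  | cO => fun _ => True
  | cS o' => sep_deriv d f a b (sep_iter d f a b o')
  | cLim s => fun x => forall n, sep_iter d f a b (s n) x
  end.

Definition sep_rank_le {X : Type} (d : X -> X -> R) (f : X -> R) (o : cord) : Prop :=
  forall a b : Q, (a < b)%Q -> forall x, ~ sep_iter d f (Q2R a) (Q2R b) o x.

(* Main.v *)
(** If the ranks were unbounded on [C] for some [a < b], then, as in the Kunen-Martin theorem,
    one could follow a branch of a tree on a countable set. A node is a finite piece of
    information on a pair [(L, x)], where [L] is in [C] and the finitely many points [x i] lie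
    in a high iterate of the derivative for [f_L] and are marked as elements of [f_L < a] or of
    [f_L > b], with Souslin witnesses for this. If a point survives one more derivation, there
    are points of both kinds arbitrarily close to it, so a node realised for all ordinals has a
    successor realised for all ordinals. Along an infinite branch the configurations converge to
    a single [L] in [C] and a countable set of points whose parts in [f_L < a] and in [f_L > b]
    are each dense in the whole set; this is impossible for a Baire-1 function. *)
Require Import Defs.
From Stdlib Require Import Reals QArith Qreals Lra Lia Arith.
From Stdlib Require Import Classical IndefiniteDescription FunctionalExtensionality.
From Stdlib Require Cantor.
Open Scope R_scope.

(** * Radii, convergence and metric preliminaries *)

Definition rad (m : nat) : R := / INR (S m).

Lemma rad_pos m : 0 < rad m.
Proof. apply Rinv_0_lt_compat, lt_0_INR. lia. Qed.

Lemma rad_small eps : 0 < eps -> exists m, rad m < eps.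
Proof.
  intros H. destruct (archimed_cor1 eps H) as [N [H1 H2]].
  exists (N - 1)%nat. unfold rad. now replace (S (N - 1)) with N by lia.
Qed.

(** Convergence in a countable power of a discrete space: Cantor space for [A = bool], Baire space
    for [A = nat]. *)
Definition point_conv {A : Type} (u : nat -> nat -> A) (v : nat -> A) : Prop :=
  forall j, exists N, forall k, (N <= k)%nat -> u k j = v j.

Lemma point_conv_uniform {A : Type} (u : nat -> nat -> A) v (H : point_conv u v) n :
  exists N, forall k, (N <= k)%nat -> forall j, (j < n)%nat -> u k j = v j.
Proof.
  induction n as [|n [N HN]].
  - exists 0%nat. intros; lia.
  - destruct (H n) as [M HM]. exists (N + M)%nat. intros k Hk j Hj.
    destruct (Nat.eq_dec j n) as [->|Hne]; [apply HM|apply HN]; lia.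
Qed.

Lemma point_conv_unique {A : Type} (u : nat -> nat -> A) v w :
  point_conv u v -> point_conv u w -> v = w.
Proof.
  intros H1 H2. apply functional_extensionality; intros j.
  destruct (H1 j) as [N HN], (H2 j) as [M HM].
  rewrite <- (HN (N + M)%nat), <- (HM (N + M)%nat) by lia. reflexivity.
Qed.

Lemma d_refl {X} (d : X -> X -> R) (Hd : is_metric d) x : d x x = 0.
Proof. now apply Hd. Qed.

Lemma d_sym {X} (d : X -> X -> R) (Hd : is_metric d) x y : d x y = d y x.
Proof. apply Hd. Qed.

Lemma d_tri {X} (d : X -> X -> R) (Hd : is_metric d) x y z : d x z <= d x y + d y z.
Proof. apply Hd. Qed.

Lemma d_conv_unique {X} (d : X -> X -> R) (Hd : is_metric d) u x y :
  d_conv d u x -> d_conv d u y -> x = y.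
Proof.
  intros H1 H2. apply Hd. destruct (Rle_lt_or_eq_dec 0 (d x y)) as [H|H]; auto.
  { apply Hd. }
  destruct (H1 (d x y / 2)) as [N HN]; [lra|]. destruct (H2 (d x y / 2)) as [M HM]; [lra|].
  specialize (HN (N + M)%nat ltac:(lia)). specialize (HM (N + M)%nat ltac:(lia)).
  pose proof (d_tri d Hd x (u (N + M)%nat) y) as T.
  rewrite (d_sym d Hd x (u _)) in T. lra.
Qed.

Lemma d_conv_dist_le {X} (d : X -> X -> R) (Hd : is_metric d) u v x y r :
  d_conv d u x -> d_conv d v y ->
  (exists N, forall k, (N <= k)%nat -> d (u k) (v k) <= r) -> d x y <= r.
Proof.
  intros Hu Hv [N HN]. apply Rnot_lt_le. intros Hlt.
  destruct (Hu ((d x y - r) / 2)) as [N1 H1]; [lra|].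
  destruct (Hv ((d x y - r) / 2)) as [N2 H2]; [lra|].
  set (k := (N + N1 + N2)%nat).
  specialize (HN k ltac:(lia)). specialize (H1 k ltac:(lia)). specialize (H2 k ltac:(lia)).
  pose proof (d_tri d Hd x (u k) y). pose proof (d_tri d Hd (u k) (v k) y).
  rewrite (d_sym d Hd x (u k)) in *. lra.
Qed.

Lemma d_conv_const {X} (d : X -> X -> R) (Hd : is_metric d) x : d_conv d (fun _ => x) x.
Proof. intros eps He. exists 0%nat. intros. now rewrite d_refl. Qed.

(** * Souslin sets in the product of Cantor space and [X] *)

Definition conv2 {X} (d : X -> X -> R) (y : nat -> (nat -> bool) * X) (l : (nat -> bool) * X) : Prop :=
  point_conv (fun k => fst (y k)) (fst l) /\ d_conv d (fun k => snd (y k)) (snd l).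

Lemma conv2_unique {X} (d : X -> X -> R) (Hd : is_metric d) y l l' :
  conv2 d y l -> conv2 d y l' -> l = l'.
Proof.
  intros [H1 H2] [H3 H4]. destruct l as [L x], l' as [L' x']; simpl in *.
  now rewrite (point_conv_unique _ _ _ H1 H3), (d_conv_unique d Hd _ _ _ H2 H4).
Qed.

(* A closed subset [{z | exists y, K y z}] of Baire space together with a continuous map
   [z |-> y] onto [S]; stated sequentially. *)
Definition souslin_scheme {X} (d : X -> X -> R) (K : (nat -> bool) * X -> (nat -> nat) -> Prop) : Prop :=
  forall y z z0, (forall k, K (y k) (z k)) -> point_conv z z0 ->
    exists y0, conv2 d y y0 /\ K y0 z0.

Definition souslin {X} (d : X -> X -> R) (S : (nat -> bool) * X -> Prop) : Prop :=
  exists K, (forall y, S y <-> exists z, K y z) /\ souslin_scheme d K.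

Lemma souslin_scheme_eventually {X} (d : X -> X -> R) K (HK : souslin_scheme d K) y z z0 M :
  (forall k, (M <= k)%nat -> K (y k) (z k)) -> point_conv z z0 ->
  exists y0, conv2 d y y0 /\ K y0 z0.
Proof.
  intros H Hz.
  destruct (HK (fun k => y (k + M)%nat) (fun k => z (k + M)%nat) z0) as [y0 [[C1 C2] H0]].
  - intros k. apply H. lia.
  - intros j. destruct (Hz j) as [N HN]. exists N. intros k Hk. apply HN. lia.
  - exists y0. repeat split; auto.
    + intros j. destruct (C1 j) as [N HN]. exists (N + M)%nat. intros k Hk.
      specialize (HN (k - M)%nat ltac:(lia)). simpl in HN.
      now replace (k - M + M)%nat with k in HN by lia.
    + intros eps He. destruct (C2 eps He) as [N HN]. exists (N + M)%nat. intros k Hk.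
      specialize (HN (k - M)%nat ltac:(lia)). simpl in HN.
      now replace (k - M + M)%nat with k in HN by lia.
Qed.

Lemma souslin_ext {X} (d : X -> X -> R) S S' :
  (forall y, S y <-> S' y) -> souslin d S -> souslin d S'.
Proof. intros H [K [H1 H2]]. exists K. split; auto. intros y. now rewrite <- H, H1. Qed.

(** Entry [0] of a witness names the set and the remaining entries witness membership. Along a
    convergent sequence of witnesses entry [0] is only eventually constant, so finitely many terms
    have to be dropped. *)
Lemma souslin_union {X} (d : X -> X -> R) (S : nat -> (nat -> bool) * X -> Prop) :
  (forall n, souslin d (S n)) -> souslin d (fun y => exists n, S n y).
Proof.
  intros H. apply functional_choice in H. destruct H as [K HK].
  exists (fun y z => K (z 0%nat) y (fun j => z (Datatypes.S j))). split.
  - intros y. split.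
    + intros [n Hn]. apply HK in Hn. destruct Hn as [z Hz].
      now exists (fun j => match j with O => n | Datatypes.S j => z j end).
    + intros [z Hz]. exists (z 0%nat). apply HK. now exists (fun j => z (Datatypes.S j)).
  - intros y z z0 Hy Hz. destruct (Hz 0%nat) as [M HM].
    apply (souslin_scheme_eventually d _ (proj2 (HK (z0 0%nat)))
             y (fun k j => z k (Datatypes.S j)) _ M).
    + intros k Hk. rewrite <- (HM k Hk). apply Hy.
    + intros j. apply Hz.
Qed.

(** One witness interleaves witnesses for all [n] by the Cantor pairing. The schemes each produce a
    limit of the same sequence [y], so these limits coincide. *)
Lemma souslin_inter {X} (d : X -> X -> R) (Hd : is_metric d) (S : nat -> (nat -> bool) * X -> Prop) :
  (forall n, souslin d (S n)) -> souslin d (fun y => forall n, S n y).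
Proof.
  intros H. apply functional_choice in H. destruct H as [K HK].
  exists (fun y z => forall n, K n y (fun j => z (Cantor.to_nat (n, j)))). split.
  - intros y. split.
    + intros Hy. assert (Hz : forall n, exists z, K n y z) by (intros n; now apply HK).
      apply functional_choice in Hz. destruct Hz as [z Hz].
      exists (fun q => z (fst (Cantor.of_nat q)) (snd (Cantor.of_nat q))). intros n.
      match goal with |- K n y ?h => replace h with (z n) end; auto.
      apply functional_extensionality. intros j. now rewrite Cantor.cancel_of_to.
    + intros [z Hz] n. apply HK. eexists. apply Hz.
  - intros y z z0 Hy Hz.
    assert (Hn : forall n, exists y0, conv2 d y y0 /\ K n y0 (fun j => z0 (Cantor.to_nat (n, j)))).
    { intros n. apply (proj2 (HK n) y (fun k j => z k (Cantor.to_nat (n, j)))).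
      - intros k. apply Hy.
      - intros j. apply Hz. }
    destruct (Hn 0%nat) as [y0 [C0 _]]. exists y0. split; auto. intros n.
    destruct (Hn n) as [y1 [C1 H1]]. now rewrite (conv2_unique d Hd y y0 y1).
Qed.

Lemma souslin_or {X} (d : X -> X -> R) (S T : (nat -> bool) * X -> Prop) :
  souslin d S -> souslin d T -> souslin d (fun y => S y \/ T y).
Proof.
  intros HS HT. apply (souslin_ext d (fun y => exists n, match n with O => S y | _ => T y end)).
  - intros y. split.
    + intros [[|n] H]; auto.
    + intros [H|H]; [now exists 0%nat|now exists 1%nat].
  - apply (souslin_union d (fun n y => match n with O => S y | _ => T y end)).
    now intros [|n].
Qed.

Lemma souslin_and {X} (d : X -> X -> R) (Hd : is_metric d) (S T : (nat -> bool) * X -> Prop) :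
  souslin d S -> souslin d T -> souslin d (fun y => S y /\ T y).
Proof.
  intros HS HT. apply (souslin_ext d (fun y => forall n, match n with O => S y | _ => T y end)).
  - intros y. split.
    + intros H. exact (conj (H 0%nat) (H 1%nat)).
    + now intros [H1 H2] [|n].
  - apply (souslin_inter d Hd (fun n y => match n with O => S y | _ => T y end)).
    now intros [|n].
Qed.

(* [z j] codes the bit [L j] together with the index of a point of the dense sequence at
   distance at most [1/(j+1)] from [x]. *)
Lemma souslin_full {X} (d : X -> X -> R) (HX : polish d) : souslin d (fun _ => True).
Proof.
  destruct HX as [Hd [Hc [s Hs]]].
  exists (fun (y : (nat -> bool) * X) z =>
    (forall j, fst (Cantor.of_nat (z j)) = if fst y j then 1%nat else 0%nat) /\
    (forall j, exists p, s (snd (Cantor.of_nat (z j))) = Some p /\ d (snd y) p <= rad j)).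
  split.
  - intros [L x]. split; auto. intros _.
    assert (H : forall j, exists n p, s n = Some p /\ d x p <= rad j).
    { intros j. destruct (Hs x _ (rad_pos j)) as (n & p & H1 & H2).
      exists n, p. split; auto. lra. }
    apply functional_choice in H. destruct H as [q Hq].
    exists (fun j => Cantor.to_nat (if L j then 1 else 0, q j)%nat).
    split; intros j; rewrite Cantor.cancel_of_to; [reflexivity|apply Hq].
  - intros y z z0 Hy Hz.
    (* Once entry [j] has stabilised, all later [snd (y k)] are within [rad j] of one and the same
       point of the dense sequence. *)
    assert (Hx : exists x, d_conv d (fun k => snd (y k)) x).
    { apply Hc. intros eps He. destruct (rad_small (eps / 2)) as [j Hj]; [lra|].
      destruct (Hz j) as [N HN]. exists N. intros n m Hn Hm.
      destruct (proj2 (Hy n) j) as (p & E1 & D1), (proj2 (Hy m) j) as (p' & E2 & D2).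
      rewrite HN in E1, E2 by auto. rewrite E1 in E2. injection E2 as <-.
      pose proof (d_tri d Hd (snd (y n)) p (snd (y m))).
      rewrite (d_sym d Hd p) in *. lra. }
    destruct Hx as [x Hx].
    exists ((fun j => Nat.eqb (fst (Cantor.of_nat (z0 j))) 1), x). split; [split|split]; simpl; auto.
    + intros j. destruct (Hz j) as [N HN]. exists N. intros k Hk.
      rewrite <- (HN k Hk), (proj1 (Hy k) j). now destruct (fst (y k) j).
    + intros j. destruct (Hz j) as [N HN].
      rewrite <- (HN N), (proj1 (Hy N) j) by auto. now destruct (fst (y N) j).
    + intros j. destruct (Hz j) as [N HN].
      destruct (proj2 (Hy N) j) as (p & E & _). rewrite (HN N) in E by auto.
      exists p. split; auto.
      apply (d_conv_dist_le d Hd _ (fun _ => p) x p _ Hx (d_conv_const d Hd p)).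
      exists N. intros k Hk. destruct (proj2 (Hy k) j) as (p' & E' & D).
      rewrite HN in E' by auto. rewrite E in E'. now injection E' as <-.
Qed.

(** Restrict the scheme of the full space to [S]: it supplies the limit point, and closedness puts
    that point in [S]. *)
Lemma souslin_closed {X} (d : X -> X -> R) (HX : polish d) (S : (nat -> bool) * X -> Prop) :
  (forall y y0, (forall k, S (y k)) -> conv2 d y y0 -> S y0) -> souslin d S.
Proof.
  intros HS. destruct (souslin_full d HX) as [K [H1 H2]].
  exists (fun y z => S y /\ K y z). split.
  - intros y. split.
    + intros Hy. destruct (proj1 (H1 y) I) as [z Hz]. now exists z.
    + now intros [z [Hy _]].
  - intros y z z0 Hy Hz. destruct (H2 y z z0) as [y0 [C0 K0]]; auto.
    { apply Hy. }
    exists y0. repeat split; try apply C0; auto. apply (HS y); auto. apply Hy.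
Qed.

(** Souslin sets are not closed under complement in general, so the induction carries each set
    together with its complement. *)
Lemma souslin_borel {X T} (d : X -> X -> R) (Hd : is_metric d)
  (op : (T -> Prop) -> Prop) (p : (nat -> bool) * X -> T)
  (Hop : forall U, op U -> souslin d (fun y => U (p y)) /\ souslin d (fun y => ~ U (p y))) A :
  borel op A -> souslin d (fun y => A (p y)) /\ souslin d (fun y => ~ A (p y)).
Proof.
  induction 1 as [U HU|A HA [IH1 IH2]|A HA IH]; auto.
  - split; auto. apply (souslin_ext d (fun y => A (p y))); auto.
    intros y. split; [tauto|apply NNPP].
  - split.
    + apply (souslin_union d (fun n y => A n (p y))). apply IH.
    + apply (souslin_ext d (fun y => forall n, ~ A n (p y))).
      * intros y. firstorder.
      * apply (souslin_inter d Hd (fun n y => ~ A n (p y))). apply IH.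
Qed.

Lemma souslin_borel_snd {X} (d : X -> X -> R) (HX : polish d) A :
  borel (d_open d) A -> souslin d (fun y => A (snd y)).
Proof.
  intros HA. apply (souslin_borel d (proj1 HX) (d_open d)); auto.
  pose proof (proj1 HX) as Hd. intros U HU. split.
  (* An open set is the countable union over [m] of the closed sets of centres whose ball of radius
     [rad m] lies in it. *)
  - apply (souslin_ext d (fun y => exists m, forall w, d (snd y) w < rad m -> U w)).
    + intros [L x]; simpl. split.
      * intros [m H]. apply H. rewrite d_refl; auto. apply rad_pos.
      * intros Hx. destruct (HU x Hx) as (eps & He & H). destruct (rad_small eps He) as [m Hm].
        exists m. intros w Hw. apply H. lra.
    + apply (souslin_union d (fun m y => forall w, d (snd y) w < rad m -> U w)).
      intros m. apply (souslin_closed d HX). intros y y0 Hy [_ C] w Hw.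
      destruct (C (rad m - d (snd y0) w)) as [N HN]; [lra|].
      apply (Hy N). specialize (HN N ltac:(lia)). simpl in HN.
      pose proof (d_tri d Hd (snd (y N)) (snd y0) w). lra.
  - apply (souslin_closed d HX). intros y y0 Hy [_ C] H.
    destruct (HU _ H) as (eps & He & H'). destruct (C eps He) as [N HN].
    apply (Hy N), H'. rewrite (d_sym d Hd). apply HN. lia.
Qed.

Lemma souslin_borel_fst {X} (d : X -> X -> R) (HX : polish d) B :
  borel cantor_open B -> souslin d (fun y => B (fst y)).
Proof.
  intros HB. apply (souslin_borel d (proj1 HX) cantor_open); auto.
  intros U HU. split.
  - apply (souslin_ext d
      (fun y => exists n, forall M, (forall k, (k < n)%nat -> M k = fst y k) -> U M)).
    + intros [L x]; simpl. split.
      * intros [n H]. now apply H.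
      * intros HL. now apply HU.
    + apply (souslin_union d
        (fun n y => forall M, (forall k, (k < n)%nat -> M k = fst y k) -> U M)).
      intros n. apply (souslin_closed d HX). intros y y0 Hy [C _] M HM.
      destruct (point_conv_uniform _ _ C n) as [N HN].
      apply (Hy N). intros k Hk. rewrite HM by auto. symmetry. now apply (HN N).
  - apply (souslin_closed d HX). intros y y0 Hy [C _] H.
    destruct (HU _ H) as [n Hn]. destruct (point_conv_uniform _ _ C n) as [N HN].
    apply (Hy N), Hn. intros k Hk. now apply (HN N).
Qed.

Lemma souslin_bit {X} (d : X -> X -> R) (HX : polish d) m b : souslin d (fun y => fst y m = b).
Proof.
  apply (souslin_closed d HX). intros y y0 Hy [C _]. destruct (C m) as [N HN].
  now rewrite <- (HN N).
Qed.

Lemma souslin_infsets {X} (d : X -> X -> R) (HX : polish d) C :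
  borel_in_infsets C -> souslin d (fun y => C (fst y)).
Proof.
  intros [B [HB HC]]. pose proof (proj1 HX) as Hd.
  apply (souslin_ext d (fun y => (forall n, exists m, fst y (n + m)%nat = true) /\ B (fst y))).
  - intros [L x]; simpl. rewrite HC. apply and_iff_compat_r. split; intros H n.
    + destruct (H n) as [m Hm]. exists (n + m)%nat. split; auto. lia.
    + destruct (H n) as [m [H1 H2]]. exists (m - n)%nat. now replace (n + (m - n))%nat with m by lia.
  - apply (souslin_and d Hd); [|now apply souslin_borel_fst].
    apply (souslin_inter d Hd (fun n y => exists m, fst y (n + m)%nat = true)). intros n.
    apply (souslin_union d (fun m y => fst y (n + m)%nat = true)). intros m.
    now apply souslin_bit.
Qed.

(** * Enumerations of infinite sets, and membership of the limit value in an open set *)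

Lemma increasing_enum_exists L : infinite_set L -> exists e, increasing_enum L e.
Proof.
  intros HL.
  assert (H : forall n, exists m, (n <= m)%nat /\ L m = true /\
    forall j, (n <= j < m)%nat -> L j = false).
  { intros n. destruct (HL n) as [m Hm]. revert m Hm.
    apply (well_founded_induction lt_wf (fun m => (n <= m)%nat /\ L m = true -> _)).
    intros m IH [H1 H2].
    destruct (classic (exists j, (n <= j < m)%nat /\ L j = true)) as [[j [Hj Lj]]|Hno].
    - apply (IH j); [lia|]. split; [lia|auto].
    - exists m. repeat split; auto. intros j Hj. destruct (L j) eqn:E; auto.
      exfalso. apply Hno. now exists j. }
  apply functional_choice in H. destruct H as [nx Hnx].
  set (e := fix e k := match k with O => nx O | S k => nx (S (e k)) end).
  assert (Hinc : forall k, (e k < e (S k))%nat).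
  { intros k. simpl. destruct (Hnx (S (e k))). lia. }
  exists e. split; auto. intros m. split.
  - intros Hm. assert (Hge : forall k, (k <= e k)%nat).
    { induction k; [lia|]. specialize (Hinc k). lia. }
    (* No element of [L] is skipped: between consecutive values of [e], and below the first one, [L]
       is [false]. *)
    assert (Hall : forall k, (m < e k)%nat -> exists j, e j = m).
    { induction k; intros Hk.
      - destruct (Hnx 0%nat) as (_ & _ & Hg). change (m < nx 0)%nat in Hk.
        rewrite Hg in Hm by lia. discriminate.
      - destruct (lt_eq_lt_dec m (e k)) as [[Hlt| ->]|Hgt]; eauto.
        destruct (Hnx (S (e k))) as (_ & _ & Hg). simpl in Hk.
        rewrite Hg in Hm by lia. discriminate. }
    apply (Hall (S m)). specialize (Hge (S m)). lia.
  - intros [[|k] <-]; apply Hnx.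
Qed.

Lemma increasing_enum_ge L e (He : increasing_enum L e) k : (k <= e k)%nat.
Proof. induction k; [lia|]. pose proof (proj1 He k). lia. Qed.

Lemma increasing_enum_lt_cancel L e (He : increasing_enum L e) i j : (e i <= e j)%nat -> (i <= j)%nat.
Proof.
  intros H. destruct (Nat.le_gt_cases i j) as [|Hlt]; auto. exfalso.
  assert (Hm : forall n, (e j < e (S n + j))%nat).
  { induction n; simpl; [apply (proj1 He)|]. pose proof (proj1 He (S (n + j))). simpl in *. lia. }
  specialize (Hm (i - j - 1)%nat). replace (S (i - j - 1) + j)%nat with i in Hm by lia. lia.
Qed.

(** A closed inner approximation of [U]; an open [U] is the union of these over [m]. The uniform
    margin is what survives passage to the limit. *)
Definition robust (U : R -> Prop) (m : nat) (v : R) : Prop :=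
  forall w, Rabs (w - v) < rad m -> U w.

Lemma robust_compl_open U m : open_set (fun v => ~ robust U m v).
Proof.
  intros v Hv. apply not_all_ex_not in Hv. destruct Hv as [w Hw].
  apply imply_to_and in Hw. destruct Hw as [H1 H2].
  assert (Hp : 0 < rad m - Rabs (w - v)) by lra.
  exists (mkposreal _ Hp). intros v' Hv' Hr. apply H2, Hr.
  unfold disc in Hv'. simpl in Hv'.
  replace (w - v') with ((w - v) - (v' - v)) by ring.
  pose proof (Rabs_triang (w - v) (- (v' - v))) as T. rewrite Rabs_Ropp in T.
  unfold Rminus at 1. lra.
Qed.

(* For [U] open this says that [f_L x] is in [U], without mentioning the limit function. *)
Definition lim_in {X} (C : (nat -> bool) -> Prop) (f : nat -> X -> R) (U : R -> Prop)
  (y : (nat -> bool) * X) : Prop :=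
  C (fst y) /\ exists m N, forall k, fst y (N + k)%nat = true -> robust U m (f (N + k)%nat (snd y)).

Lemma lim_in_iff {X} C (f : nat -> X -> R) U (HU : open_set U) L g x :
  C L -> infinite_set L -> subseq_conv f L g -> lim_in C f U (L, x) <-> U (g x).
Proof.
  intros HC HL Hg. destruct (increasing_enum_exists L HL) as [e He].
  pose proof (Hg e He x) as Hcv. unfold lim_in. simpl. split.
  - intros [_ (m & N & H)]. destruct (Hcv (rad m) (rad_pos m)) as [M HM].
    specialize (HM (N + M)%nat ltac:(lia)).
    pose proof (increasing_enum_ge L e He (N + M)) as Hge.
    specialize (H (e (N + M) - N)%nat).
    replace (N + (e (N + M) - N))%nat with (e (N + M)%nat) in H by lia.
    apply H.
    + apply (proj2 He). now eexists.
    + rewrite Rabs_minus_sym. exact HM.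
  - intros Hx. split; auto. destruct (HU _ Hx) as [[dl Hdl] Hincl].
    (* One half of [dl] bounds the distance from [w] to [f (e j) x], the other half the distance
       from there to [g x]. *)
    destruct (rad_small (dl / 2)) as [m Hm]; [lra|].
    destruct (Hcv (dl / 2)) as [M HM]; [lra|].
    exists m, (e M). intros k Hk w Hw. apply Hincl. unfold disc; simpl.
    destruct (proj1 (proj2 He _) Hk) as [j Hj]. rewrite <- Hj in Hw.
    assert (M <= j)%nat by (apply (increasing_enum_lt_cancel L e He); lia).
    specialize (HM j ltac:(lia)). unfold Rdist in HM.
    replace (w - g x) with ((w - f (e j) x) + (f (e j) x - g x)) by ring.
    pose proof (Rabs_triang (w - f (e j) x) (f (e j) x - g x)). lra.
Qed.

Lemma souslin_lim_in {X} (d : X -> X -> R) (HX : polish d) (f : nat -> X -> R)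
  (Hf : forall n, borel_fun d (f n)) C (HC : borel_in_infsets C) U :
  souslin d (lim_in C f U).
Proof.
  pose proof (proj1 HX) as Hd.
  apply (souslin_and d Hd (fun y => C (fst y))); [now apply souslin_infsets|].
  apply (souslin_union d (fun m y => exists N, forall k, fst y (N + k)%nat = true ->
    robust U m (f (N + k)%nat (snd y)))). intros m.
  apply (souslin_union d (fun N y => forall k, fst y (N + k)%nat = true ->
    robust U m (f (N + k)%nat (snd y)))). intros N.
  apply (souslin_inter d Hd (fun k y => fst y (N + k)%nat = true ->
    robust U m (f (N + k)%nat (snd y)))). intros k.
  apply (souslin_ext d (fun y => fst y (N + k)%nat = false \/ robust U m (f (N + k)%nat (snd y)))).
  - intros [L x]; simpl. destruct (L (N + k)%nat); intuition congruence.
  - apply souslin_or; [now apply souslin_bit|].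
    (* The double negation exhibits the set as the complement of a preimage of an open set. *)
    apply (souslin_ext d (fun y => ~ ~ robust U m (f (N + k)%nat (snd y)))).
    { intros y. split; [apply NNPP|tauto]. }
    apply (souslin_borel_snd d HX (fun x => ~ ~ robust U m (f (N + k)%nat x))).
    apply borel_compl, (Hf (N + k)%nat _ (robust_compl_open U m)).
Qed.

(** * Iterates of the separation derivative *)

Lemma sep_iter_closed {X} (d : X -> X -> R) (Hd : is_metric d) g a b o x :
  d_closure d (sep_iter d g a b o) x -> sep_iter d g a b o x.
Proof.
  revert x. induction o as [|o IH|s IH]; simpl; auto.
  - intros x H. split; intros eps He; destruct (H (eps / 2)) as [y [[H1 H2] Hxy]]; try lra;
      [destruct (H1 (eps / 2)) as [z [Hz Hyz]]|destruct (H2 (eps / 2)) as [z [Hz Hyz]]]; try lra;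
      exists z; split; auto; pose proof (d_tri d Hd x y z); lra.
  - intros x H n. apply IH. intros eps He. destruct (H eps He) as [y [Hy Hxy]]. eauto.
Qed.

(** The derivative lies in the closure of the previous iterate, which is already closed. *)
Lemma sep_iter_decreasing {X} (d : X -> X -> R) (Hd : is_metric d) g a b o x :
  sep_iter d g a b (cS o) x -> sep_iter d g a b o x.
Proof.
  intros [H _]. apply (sep_iter_closed d Hd). intros eps He.
  destruct (H eps He) as [y [[Hy _] Hxy]]. eauto.
Qed.

Definition side (a b : R) (t : bool) (v : R) : Prop := if t then v < a else b < v.

Lemma side_open a b t : open_set (side a b t).
Proof.
  intros v Hv. destruct t; simpl in Hv.
  - assert (Hp : 0 < a - v) by lra. exists (mkposreal _ Hp). intros w Hw.
    unfold disc in Hw; simpl in *. apply Rabs_def2 in Hw. lra.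
  - assert (Hp : 0 < v - b) by lra. exists (mkposreal _ Hp). intros w Hw.
    unfold disc in Hw; simpl in *. apply Rabs_def2 in Hw. lra.
Qed.

Lemma sep_iter_near {X} (d : X -> X -> R) g a b o x eps t :
  sep_iter d g a b (cS o) x -> 0 < eps ->
  exists y, sep_iter d g a b o y /\ side a b t (g y) /\ d x y < eps.
Proof.
  intros [H1 H2] He.
  destruct t; [destruct (H1 eps He) as (y & [? ?] & ?)|destruct (H2 eps He) as (y & [? ?] & ?)];
    now exists y.
Qed.

(** * Oscillation of Baire-1 functions *)

(** Both sides are open: first some late [h n x] is on the side of [g x], then by continuity so is
    [h n] on a small ball. The ball is closed so that limits of nested centres stay in it. *)
Lemma baire1_ball {X} (d : X -> X -> R) h g (Hh : forall n, d_continuous d (h n))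
  (Hcv : forall x, Un_cv (fun n => h n x) (g x)) a b t x r k :
  side a b t (g x) -> 0 < r ->
  exists n r', (k <= n)%nat /\ 0 < r' <= r /\ forall y, d x y <= r' -> side a b t (h n y).
Proof.
  intros Hx Hr. destruct (side_open a b t _ Hx) as [[e1 He1] Hi1].
  destruct (Hcv x e1 He1) as [N HN].
  specialize (HN (N + k)%nat ltac:(lia)). apply Hi1 in HN.
  destruct (side_open a b t _ HN) as [[e2 He2] Hi2].
  destruct (Hh (N + k)%nat x e2 He2) as (dl & Hdl & H).
  exists (N + k)%nat, (Rmin r (dl / 2)). split; [lia|].
  pose proof (Rmin_l r (dl / 2)). pose proof (Rmin_r r (dl / 2)).
  assert (0 < Rmin r (dl / 2)) by (apply Rmin_pos; lra).
  split; [lra|]. intros y Hy. apply Hi2. unfold disc; simpl. apply H. lra.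
Qed.

(* Nested balls on which alternately some [h n < a] and some [h n > b] shrink to a point where
   [h n] has no limit. *)
Lemma baire1_not_oscillating {X} (d : X -> X -> R) (Hd : is_metric d) (Hc : d_complete d)
  g (Hg : baire1 d g) a b (Hab : a < b) (D : bool -> X -> Prop)
  (HD : forall t x, D t x -> side a b t (g x))
  (Hcl : forall t t' x, D t x -> d_closure d (D t') x) x : ~ D true x.
Proof.
  intros Hx. destruct Hg as (h & Hh & Hcv).
  (* After shrinking to a ball where [h n] is on side [t], recentre at a point of the opposite kind;
     half the radius keeps the new ball inside. *)
  assert (half : forall t k c r, D t c -> 0 < r -> exists n c' r', (k <= n)%nat /\
    D (negb t) c' /\ 0 < r' <= r / 2 /\ (forall y, d c' y <= r' -> d c y <= r /\ side a b t (h n y))).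
  { intros t k c r Hcr Hr.
    destruct (baire1_ball d h g Hh Hcv a b t c r k (HD t c Hcr) Hr) as (n & r1 & Hn & Hr1 & H1).
    destruct (Hcl t (negb t) c Hcr (r1 / 2)) as (c' & Hc' & Hd'); [lra|].
    exists n, c', (r1 / 2). repeat split; auto; try lra;
      try apply H1; pose proof (d_tri d Hd c c' y); lra. }
  (* Two half steps, one per side. The invariants are premises inside the existential so that choice
     yields a total function. *)
  assert (step : forall s : nat * (X * R), exists s' : X * R,
    D true (fst (snd s)) -> 0 < snd (snd s) ->
    D true (fst s') /\ 0 < snd s' <= snd (snd s) / 2 /\
    exists n n', (fst s <= n)%nat /\ (fst s <= n')%nat /\ forall y, d (fst s') y <= snd s' ->
      d (fst (snd s)) y <= snd (snd s) /\ h n y < a /\ b < h n' y).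
  { intros [k [c r]]; simpl.
    destruct (classic (D true c /\ 0 < r)) as [[H1 H2]|H]; [|exists (c, r); tauto].
    destruct (half true k c r H1 H2) as (n & c' & r' & Hn & Hc' & Hr' & H).
    destruct (half false k c' r' Hc' ltac:(lra)) as (n' & c'' & r'' & Hn' & Hc'' & Hr'' & H').
    exists (c'', r''). intros _ _. simpl. repeat split; auto; try lra.
    exists n, n'. repeat split; auto; destruct (H' y) as [E1 E2]; auto; now apply H. }
  apply functional_choice in step. destruct step as [F HF].
  set (s := fix s k := match k with O => (x, 1) | S k => F (k, s k) end).
  assert (Hs : forall k, D true (fst (s k)) /\ 0 < snd (s k)).
  { induction k as [|k [H1 H2]]; simpl; [split; auto; lra|].
    destruct (HF (k, s k) H1 H2) as (H3 & H4 & _). split; [exact H3|apply H4]. }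
  assert (Hst : forall k, 0 < snd (s (S k)) <= snd (s k) / 2 /\
    exists n n', (k <= n)%nat /\ (k <= n')%nat /\ forall y, d (fst (s (S k))) y <= snd (s (S k)) ->
      d (fst (s k)) y <= snd (s k) /\ h n y < a /\ b < h n' y).
  { intros k. destruct (Hs k) as [H1 H2]. destruct (HF (k, s k) H1 H2) as (_ & H4). exact H4. }
  (* The radii at least halve from [1], and [(k + 2) / 2 <= k + 1]. *)
  assert (Hr : forall k, snd (s k) <= rad k).
  { assert (Hp : forall k, snd (s k) * INR (S k) <= 1).
    { induction k; [simpl; lra|]. destruct (Hst k) as [H _].
      rewrite !S_INR in *. pose proof (pos_INR k). nra. }
    intros k. unfold rad. apply (Rmult_le_reg_r (INR (S k))); [apply lt_0_INR; lia|].
    rewrite Rinv_l; [apply Hp|]. apply not_0_INR. lia. }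
  assert (Hnest : forall m k y, d (fst (s (m + k)%nat)) y <= snd (s (m + k)%nat) ->
    d (fst (s k)) y <= snd (s k)).
  { induction m; intros k y Hy; auto. apply IHm.
    destruct (Hst (m + k)%nat) as [_ (n & n' & _ & _ & H)]. now apply H. }
  assert (Hcen : forall k n, (k <= n)%nat -> d (fst (s k)) (fst (s n)) <= snd (s k)).
  { intros k n Hn. apply (Hnest (n - k)%nat). replace (n - k + k)%nat with n by lia.
    rewrite d_refl; auto. left. apply Hs. }
  destruct (Hc (fun k => fst (s k))) as [y Hy].
  { intros eps He. destruct (rad_small (eps / 2)) as [N HN]; [lra|]. exists N.
    intros n m Hn Hm. pose proof (Hcen N n Hn). pose proof (Hcen N m Hm). specialize (Hr N).
    pose proof (d_tri d Hd (fst (s n)) (fst (s N)) (fst (s m))).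
    rewrite (d_sym d Hd (fst (s n)) (fst (s N))) in *. lra. }
  assert (Hin : forall k, d (fst (s k)) y <= snd (s k)).
  { intros k. apply (d_conv_dist_le d Hd (fun _ => fst (s k)) (fun n => fst (s n)));
      [now apply d_conv_const|auto|].
    exists k. intros n Hn. now apply Hcen. }
  (* Past [N] all [h n y] are within [(b - a) / 2] of [g y], yet one is below [a] and another above
     [b]. *)
  destruct (Hcv y ((b - a) / 2)) as [N HN]; [lra|].
  destruct (Hst N) as [_ (n & n' & Hn & Hn' & H)]. destruct (H y (Hin _)) as (_ & H1 & H2).
  pose proof (HN n ltac:(lia)) as E1. pose proof (HN n' ltac:(lia)) as E2.
  unfold Rdist in *. apply Rabs_def2 in E1, E2. lra.
Qed.

(** * Configurations and their limits along a branch *)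

(* Every task [(p, m, t)] asks for a point on side [t] within [rad m] of the point [p]; the
   point number [S i] of a configuration fulfils the task coded by [i]. *)
Definition anchor (i : nat) : nat := fst (Cantor.of_nat i).
Definition precision (i : nat) : nat := fst (Cantor.of_nat (snd (Cantor.of_nat i))).
Definition target (i : nat) : bool := Nat.eqb (snd (Cantor.of_nat (snd (Cantor.of_nat i)))) 0.

(** Hence the anchor of task [i] is already present when point [S i] is added. *)
Lemma anchor_le i : (anchor i <= i)%nat.
Proof.
  unfold anchor. rewrite <- (Cantor.cancel_to_of i) at 2.
  destruct (Cantor.of_nat i) as [p q]; simpl fst.
  pose proof (Cantor.to_nat_non_decreasing p q). lia.
Qed.

Lemma task_surj p m t : exists i, anchor i = p /\ precision i = m /\ target i = t.
Proof.
  exists (Cantor.to_nat (p, Cantor.to_nat (m, if t then 0 else 1)))%nat.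
  unfold anchor, precision, target.
  rewrite Cantor.cancel_of_to. cbn [fst snd]. rewrite Cantor.cancel_of_to. now destruct t.
Qed.

(* The label [l] records, for [q = <i, j> < k], only the entry [j] of the Souslin witness of point
   [S i]. Point [0] is on neither side. *)
Definition configuration {X} (d : X -> X -> R) (f : nat -> X -> R) (C : (nat -> bool) -> Prop)
  (a b : R) (K : bool -> (nat -> bool) * X -> (nat -> nat) -> Prop)
  (k : nat) (l : nat -> nat) (o : cord) L x z : Prop :=
  C L /\
  (exists g, subseq_conv f L g /\ forall i, (i <= k)%nat -> sep_iter d g a b o (x i)) /\
  (forall i, (i < k)%nat ->
     K (target i) (L, x (S i)) (z i) /\ d (x (anchor i)) (x (S i)) < rad (precision i)) /\
  (forall q, (q < k)%nat -> z (fst (Cantor.of_nat q)) (snd (Cantor.of_nat q)) = l q).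

Definition update {A} (u : nat -> A) (k : nat) (v : A) (i : nat) : A :=
  if Nat.eqb i k then v else u i.

Lemma update_eq {A} (u : nat -> A) k v : update u k v k = v.
Proof. unfold update. now rewrite Nat.eqb_refl. Qed.

Lemma update_neq {A} (u : nat -> A) k v i : i <> k -> update u k v i = u i.
Proof. unfold update. now intros ->%Nat.eqb_neq. Qed.

(** The outer [cS] pays for one new point near its anchor. That point and the old ones lie in the
    iterate [cLim s], hence in the iterate [s n] for every [n]; so the label [n] may be read off
    after the point and its witness are chosen. *)
Lemma configuration_extend {X} (d : X -> X -> R) (Hd : is_metric d) f C a b K
  (HCL : forall L, C L -> infinite_set L)
  (HK : forall t y, lim_in C f (side a b t) y <-> exists z, K t y z) k l s :
  (exists L x z, configuration d f C a b K k l (cS (cLim s)) L x z) ->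
  exists n, exists L x z, configuration d f C a b K (S k) (update l k n) (s n) L x z.
Proof.
  intros (L & x & z & HL & (g & Hg & Hx) & HT & Hz).
  destruct (sep_iter_near d g a b _ (x (anchor k)) (rad (precision k)) (target k)
              (Hx _ (anchor_le k)) (rad_pos _)) as (w & Hw & Hs & Hdw).
  apply (lim_in_iff C f _ (side_open a b (target k)) L g w HL (HCL L HL) Hg) in Hs.
  apply HK in Hs. destruct Hs as [v Hv].
  (* The whole witness of the new point becomes row [k]; the label records a single further entry of
     the array. *)
  set (z' := update z k v).
  exists (z' (fst (Cantor.of_nat k)) (snd (Cantor.of_nat k))), L, (update x (S k) w), z'.
  split; [auto|split; [exists g; split; auto|split]].
  - intros i Hi. destruct (Nat.eq_dec i (S k)) as [->|Hne].
    + rewrite update_eq. apply Hw.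
    + rewrite update_neq by auto.
      apply (sep_iter_decreasing d Hd g a b (cLim s)), Hx. lia.
  - intros i Hi. pose proof (anchor_le i). rewrite (update_neq x (S k) w (anchor i)) by lia.
    unfold z'. destruct (Nat.eq_dec i k) as [->|Hne].
    + now rewrite !update_eq.
    + rewrite !update_neq by lia. apply HT. lia.
  - intros q Hq. destruct (Nat.eq_dec q k) as [->|Hne].
    + now rewrite update_eq.
    + rewrite (update_neq l) by auto. rewrite <- Hz by lia.
      unfold z'. rewrite update_neq; auto.
      (* The row of [q] is at most [q < k], so it is not the new row [k]. *)
      pose proof (anchor_le q). unfold anchor in *. lia.
Qed.

(* The limit of configurations whose labels lie on one branch; different configurations on the
   branch may be based on different [L] and [x]. *)
Lemma no_infinite_branch {X} (d : X -> X -> R) (HX : polish d) f C a b (Hab : a < b) K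
  (HCL : forall L, C L -> infinite_set L /\ exists g, subseq_conv f L g /\ baire1 d g)
  (HK : forall t y, lim_in C f (side a b t) y <-> exists z, K t y z)
  (HS : forall t, souslin_scheme d (K t)) (l : nat -> nat) (o : nat -> cord) :
  ~ forall k, exists L x z, configuration d f C a b K k l (o k) L x z.
Proof.
  intros H. pose proof HX as [Hd [Hc _]].
  apply functional_choice in H. destruct H as [L H].
  apply functional_choice in H. destruct H as [x H].
  apply functional_choice in H. destruct H as [z H].
  (* The labels prescribe entry [j] of row [i] for all [k] beyond the code of [(i, j)], so row [i]
     converges and the scheme yields a limit pair. *)
  assert (Hlim : forall i, exists y0 z0,
    conv2 d (fun k => (L k, x k (S i))) y0 /\ K (target i) y0 z0).
  { intros i.
    destruct (souslin_scheme_eventually d _ (HS (target i)) (fun k => (L k, x k (S i)))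
      (fun k => z k i) (fun j => l (Cantor.to_nat (i, j))) (S i)) as [y0 [Hy Hy']]; eauto.
    - intros k Hk. now apply (H k).
    - intros j. exists (S (Cantor.to_nat (i, j))). intros k Hk.
      destruct (H k) as (_ & _ & _ & Hz). specialize (Hz (Cantor.to_nat (i, j)) Hk).
      now rewrite Cantor.cancel_of_to in Hz. }
  apply functional_choice in Hlim. destruct Hlim as [y Hy].
  (* The first components are limits of the same sequence [L k]. *)
  assert (HL : forall i, fst (y i) = fst (y 0%nat)).
  { intros i. destruct (Hy i) as (z1 & [C1 _] & _), (Hy 0%nat) as (z2 & [C2 _] & _).
    exact (point_conv_unique _ _ _ C1 C2). }
  assert (Hin : forall i, lim_in C f (side a b (target i)) (fst (y 0%nat), snd (y i))).
  { intros i. rewrite <- (HL i), <- surjective_pairing. apply HK.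
    destruct (Hy i) as (z0 & _ & Hz). eauto. }
  destruct (HCL _ (proj1 (Hin 0%nat))) as [HLi (g & Hg & Hb)].
  assert (Hside : forall i, side a b (target i) (g (snd (y i)))).
  { intros i. specialize (Hin i). pose proof (proj1 Hin) as HC.
    apply (lim_in_iff C f _ (side_open a b _) _ g) in Hin; auto. }
  set (D t w := exists i, target i = t /\ snd (y i) = w).
  assert (Hcl : forall t t' w, D t w -> d_closure d (D t') w).
  { intros _ t' w [p [_ <-]] eps He. destruct (rad_small eps He) as [m Hm].
    (* The anchor is [S p] because [y p] is the limit of the points number [S p]. The strict
       distance bounds become weak in the limit, still below [eps]. *)
    destruct (task_surj (S p) m t') as (i & Ha & Hp & Ht).
    exists (snd (y i)). split; [now exists i|].
    destruct (Hy p) as (z1 & [_ C1] & _), (Hy i) as (z2 & [_ C2] & _).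
    apply Rle_lt_trans with (rad m); auto.
    apply (d_conv_dist_le d Hd _ _ _ _ _ C1 C2). exists (S i). intros k Hk. simpl.
    destruct (H k) as (_ & _ & HT & _). destruct (HT i Hk) as [_ Hlt].
    rewrite Ha, Hp in Hlt. lra. }
  destruct (task_surj 0 0 true) as (i & _ & _ & Ht).
  apply (baire1_not_oscillating d Hd Hc g Hb a b Hab D) with (x := snd (y i)); auto.
  - intros t w [j [<- <-]]. apply Hside.
  - now exists i.
Qed.

(** * Construction of the branch, and the bound over all rational pairs *)

Lemma sep_rank_bound_for {X} (d : X -> X -> R) (HX : polish d) (f : nat -> X -> R)
  (Hf : forall n, borel_fun d (f n)) C (HC : borel_in_infsets C)
  (HCL : forall L, C L -> infinite_set L /\ exists g, subseq_conv f L g /\ baire1 d g)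
  a b (Hab : a < b) :
  exists o : cord, forall L, C L -> forall g, subseq_conv f L g -> forall x, ~ sep_iter d g a b o x.
Proof.
  pose proof (fun t => souslin_lim_in d HX f Hf C HC (side a b t)) as HK.
  apply functional_choice in HK. destruct HK as [K HK].
  set (bad k l := forall o, exists L x z, configuration d f C a b K k l o L x z).
  apply NNPP. intros Hno.
  assert (H0 : bad 0%nat (fun _ => 0%nat)).
  { intros o. apply NNPP. intros Hx. apply Hno. exists o. intros L HL g Hg x Hxo. apply Hx.
    exists L, (fun _ => x), (fun _ _ => 0%nat).
    split; [auto|split; [now exists g|split; intros; lia]]. }
  assert (Hext : forall s : nat * (nat -> nat), exists n,
    bad (fst s) (snd s) -> bad (S (fst s)) (update (snd s) (fst s) n)).
  { intros [k l]; simpl. apply NNPP. intros Hn.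
    (* If every successor fails at some ordinal [s n], realising the node at [cS (cLim s)] gives a
       contradiction. *)
    assert (Ho : forall n, exists o,
      ~ exists L x z, configuration d f C a b K (S k) (update l k n) o L x z).
    { intros n. apply not_all_ex_not. intros Hb. apply Hn. exists n. auto. }
    apply functional_choice in Ho. destruct Ho as [s Hs].
    (* For a node that is not [bad] the implication is vacuous, with [0] as default label. *)
    assert (Hb : bad k l) by (apply NNPP; intros Hb; apply Hn; exists 0%nat; tauto).
    destruct (configuration_extend d (proj1 HX) f C a b K (fun L HL => proj1 (HCL L HL))
      (fun t => proj1 (HK t)) k l s (Hb _)) as [n Hc].
    now apply (Hs n). }
  apply functional_choice in Hext. destruct Hext as [next Hnext].
  set (u := fix u k := match k with
    | O => fun _ => 0%nat | S k => update (u k) k (next (k, u k)) end).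
  assert (Hbad : forall k, bad k (u k)).
  { induction k; [exact H0|]. exact (Hnext (k, u k) IHk). }
  (* Entry [q] is fixed from stage [S q] on, so the diagonal is a single branch extending every
     [u k]. *)
  assert (Hu : forall k q, (q < k)%nat -> u k q = u (S q) q).
  { induction k; intros q Hq; [lia|]. destruct (Nat.eq_dec q k) as [->|Hne]; auto.
    simpl u at 1. rewrite update_neq by auto. apply IHk. lia. }
  apply (no_infinite_branch d HX f C a b Hab K HCL (fun t => proj1 (HK t)) (fun t => proj2 (HK t))
    (fun q => u (S q) q) (fun _ => cO)).
  intros k. destruct (Hbad k cO) as (L & x & z & H1 & H2 & H3 & H4).
  exists L, x, z. repeat (split; auto). intros q Hq. rewrite <- (Hu k) by auto. auto.
Qed.

(** Equality here is Leibniz equality, so all fractions are listed, reduced or not; integers are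
    coded as differences of naturals. *)
Lemma Q_pairs_enumerable : exists r : nat -> Q * Q, forall p, exists n, r n = p.
Proof.
  set (zn n := let (i, j) := Cantor.of_nat n in (Z.of_nat i - Z.of_nat j)%Z).
  set (qn n := let (i, j) := Cantor.of_nat n in (zn i # Pos.of_nat j)%Q).
  exists (fun n => let (i, j) := Cantor.of_nat n in (qn i, qn j)).
  assert (Hz : forall z, exists n, zn n = z).
  { intros z. exists (Cantor.to_nat (Z.to_nat z, Z.to_nat (- z))).
    unfold zn. rewrite Cantor.cancel_of_to. lia. }
  assert (Hq : forall q, exists n, qn n = q).
  { intros [z p]. destruct (Hz z) as [i <-]. exists (Cantor.to_nat (i, Pos.to_nat p)).
    unfold qn. now rewrite Cantor.cancel_of_to, Pos2Nat.id. }
  intros [q q']. destruct (Hq q) as [i <-], (Hq q') as [j <-].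
  exists (Cantor.to_nat (i, j)). now rewrite Cantor.cancel_of_to.
Qed.

Theorem theorem4p5 (X : Type) (d : X -> X -> R) (f : nat -> X -> R)
  (HX : polish d) (Hf : forall n, borel_fun d (f n))
  (C : (nat -> bool) -> Prop) (HC : borel_in_infsets C)
  (HCL : forall L, C L -> infinite_set L /\
           exists g, subseq_conv f L g /\ baire1 d g) :
  exists o : cord, forall L, C L -> forall g, subseq_conv f L g -> sep_rank_le d g o.
Proof.
  destruct Q_pairs_enumerable as [r Hr].
  assert (H : forall n, exists o : cord, (fst (r n) < snd (r n))%Q ->
    forall L, C L -> forall g, subseq_conv f L g ->
    forall x, ~ sep_iter d g (Q2R (fst (r n))) (Q2R (snd (r n))) o x).
  { intros n. destruct (classic (fst (r n) < snd (r n))%Q) as [Hlt|Hn]; [|now exists cO].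
    destruct (sep_rank_bound_for d HX f Hf C HC HCL _ _ (Qlt_Rlt _ _ Hlt)) as [o Ho].
    now exists o. }
  apply functional_choice in H. destruct H as [s Hs].
  (* [s] need not be monotone: the iterate at [cLim s] is the intersection of all iterates [s n],
     and for each pair one of these is empty. *)
  exists (cLim s). intros L HL g Hg a b Hab x Hx.
  destruct (Hr (a, b)) as [n Hn]. specialize (Hs n). specialize (Hx n). rewrite Hn in *.
  exact (Hs Hab L HL g Hg x Hx).
Qed.
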